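(* For $\mathrm{Re}(z)>1$ and $x>0$, $$\Phi(z,x)+x^{1-z}\,\Phi\!\left(z,\frac1x\right)=\sum_{n=1}^{\infty}\sum_{m=1}^{\infty}\frac{1}{mn(n+mx)^{z-1}}-\frac{1+x^{1-z}}{z-1}\,\zeta(z)+\left(x+x^{-z}\right)\zeta(z+1).$$
   Context: The Herglotz–Hurwitz function is defined, for $\mathrm{Re}(z)>0$, $z\ne1$, and $x\in\mathbb{C}\setminus(-\infty,0]$, by $$\Phi(z,x):=\sum_{n=1}^{\infty}\frac1n\left(\zeta(z,nx)-\frac{(nx)^{1-z}}{z-1}\right),$$ where $\zeta(z,a)$ is the Hurwitz zeta function (equal to $\sum_{k=0}^\infty (k+a)^{-z}$ for $\mathrm{Re}(z)>1$). $\zeta(z)$ is the Riemann zeta function. *)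

(* Defs.v *)
From Stdlib Require Export Reals.
From Coquelicot Require Export Coquelicot.

Open Scope R_scope.
Open Scope C_scope.

Definition Cexp (w : C) : C :=
  (exp (Re w) * cos (Im w), exp (Re w) * sin (Im w))%R.

(* Principal argument by the half-angle formula: it takes values in (-PI, PI)
   and is continuous on C minus (-oo, 0].  On (-oo, 0] the quotient has
   denominator 0 and the value is meaningless. *)
Definition Carg (w : C) : R := (2 * atan (Im w / (Cmod w + Re w)))%R.

Definition Clog (w : C) : C := (ln (Cmod w), Carg w).

(* w ^ z with complex exponent, principal branch; [Cpow], written [^], only
   takes exponents in nat. *)
Definition Cpower (w z : C) : C := Cexp (z * Clog w).

Definition CSeries (a : nat -> C) : C :=
  (Series (fun n => Re (a n)), Series (fun n => Im (a n))).

Definition ex_Cseries (a : nat -> C) : Prop :=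
  @ex_series C_AbsRing C_NormedModule a.

(* The zeta functions are given by their Dirichlet series, hence only
   meaningful for Re z > 1; no analytic continuation is built in. *)
Definition zeta (z : C) : C :=
  CSeries (fun k => Cpower (INR (S k)) (- z)).

Definition hurwitz_zeta (z a : C) : C :=
  CSeries (fun k => Cpower (INR k + a) (- z)).

(* Meaningful for Re z > 1, because of [hurwitz_zeta], and x outside
   (-oo, 0].  The summation index n >= 1 is written S k. *)
Definition Phi (z x : C) : C :=
  CSeries (fun k =>
    let n := RtoC (INR (S k)) in
    1 / n * (hurwitz_zeta z (n * x) - Cpower (n * x) (1 - z) / (z - 1))).

Definition double_term (z x : C) (n m : nat) : C :=
  1 / (INR m * INR n * Cpower (INR n + INR m * x) (z - 1)).

(* Main.v *)
(** Split the term k = 0 off every Hurwitz zeta value: it contributes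
    x^(-z) zeta(z+1) to Phi(z,x), and the subtracted powers contribute
    -x^(1-z) zeta(z) / (z-1), so what is left is
    T(x) = sum_m sum_n (n + m x)^(-z) / m.  The factor x^(1-z) turns T(1/x)
    into sum_n sum_m x (n + m x)^(-z) / n.  Exchanging the two sums in T(x)
    and adding,
      (1/m + x/n) (n + m x)^(-z) = (n + m x)^(1-z) / (m n).
    The exchange is licensed by absolute convergence: with
    d = (Re z - 1) / 2, |(n + m x)^(-z)| <= (m x)^(-d) n^(-(1+d)), so the
    double series is dominated by a product of two convergent series. *)

Require Import Defs.
From Stdlib Require Import Lra Lia.

(** * Dominated convergence and exchange of real double series *)

(** Choose [M] so that the tail of [B] beyond [M] is below eps/2. This bounds the tails of all [u N]
    at once, and the first M+1 terms form a finite sum that tends to 0. *)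
Lemma Series_dominated_lim_0 (u : nat -> nat -> R) (B : nat -> R) :
  (forall N m, Rabs (u N m) <= B m)%R -> ex_series B ->
  (forall m, is_lim_seq (fun N => u N m) 0) ->
  is_lim_seq (fun N => Series (u N)) 0.
Proof.
  intros dom exB lim0.
  assert (exu : forall N, ex_series (u N)).
  { intros N. now apply (ex_series_le (u N) B). }
  assert (exua : forall N, ex_series (fun m => Rabs (u N m))).
  { intros N. apply (ex_series_le (V := R_CompleteNormedModule) _ B); auto. intros m.
    change (Rabs (Rabs (u N m)) <= B m)%R. rewrite Rabs_Rabsolu. apply dom. }
  apply is_lim_seq_spec. intros eps.
  assert (sB : is_lim_seq (sum_n B) (Series B)) by exact (Series_correct _ exB).
  apply is_lim_seq_spec in sB.
  destruct (sB (pos_div_2 eps)) as [M hM].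
  specialize (hM M (Nat.le_refl M)). rewrite sum_n_Reals in hM.
  assert (tail : (Series (fun k => B (S M + k)%nat) < eps / 2)%R).
  { rewrite (Series_incr_n B (S M)) in hM by (auto; lia).
    simpl Init.Nat.pred in hM. apply Rabs_def2 in hM. simpl in hM |- *. lra. }
  assert (head : is_lim_seq (fun N => sum_f_R0 (u N) M) 0).
  { clear - lim0. induction M as [|M IH]; simpl; auto.
    replace 0%R with (0 + 0)%R by lra. now apply is_lim_seq_plus'. }
  apply is_lim_seq_spec in head.
  destruct (head (pos_div_2 eps)) as [N0 hN0].
  exists N0. intros N hN. specialize (hN0 N hN). simpl in hN0.
  rewrite (Series_incr_n (u N) (S M)) by (auto; lia). simpl Init.Nat.pred.
  assert (tl : (Rabs (Series (fun k => u N (S M + k)%nat)) < eps / 2)%R).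
  { eapply Rle_lt_trans; [|exact tail].
    eapply Rle_trans; [apply Series_Rabs|apply Series_le].
    - apply (ex_series_incr_n (fun m => Rabs (u N m)) (S M)). auto.
    - intros k. split; [apply Rabs_pos|apply dom].
    - apply (ex_series_incr_n B (S M)). auto. }
  apply Rabs_def2 in tl. apply Rabs_def2 in hN0. apply Rabs_def1; lra.
Qed.

Lemma sum_n_le_Series (b : nat -> R) (N : nat) :
  (forall n, 0 <= b n)%R -> ex_series b -> (sum_n b N <= Series b)%R.
Proof.
  intros pos exb. apply (is_lim_seq_incr_compare (sum_n b)).
  - exact (Series_correct _ exb).
  - intros n. rewrite sum_Sn. unfold plus; simpl. generalize (pos (S n)). lra.
Qed.

Lemma term_le_Series (b : nat -> R) (n : nat) :
  (forall n, 0 <= b n)%R -> ex_series b -> (b n <= Series b)%R.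
Proof.
  intros pos exb. apply Rle_trans with (sum_n b n); [|now apply sum_n_le_Series].
  destruct n as [|n]; [rewrite sum_O; apply Rle_refl|].
  assert (0 <= sum_n b n)%R.
  { rewrite sum_n_Reals. now apply cond_pos_sum. }
  rewrite sum_Sn. unfold plus; simpl. lra.
Qed.

Lemma Rabs_sum_n_le_Series (a : nat -> R) (N : nat) :
  ex_series (fun n => Rabs (a n)) ->
  (Rabs (sum_n a N) <= Series (fun n => Rabs (a n)))%R.
Proof.
  intros exa.
  apply Rle_trans with (sum_n (fun n => Rabs (a n)) N).
  - exact (norm_sum_n_m a 0 N).
  - apply sum_n_le_Series; auto. intros n; apply Rabs_pos.
Qed.

Lemma sum_n_Series (a : nat -> nat -> R) (N : nat) :
  (forall n, ex_series (a n)) ->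
  ex_series (fun m => sum_n (fun n => a n m) N) /\
  sum_n (fun n => Series (a n)) N = Series (fun m => sum_n (fun n => a n m) N).
Proof.
  intros ex. induction N as [|N [IHex IH]].
  - rewrite sum_O. split; [eapply ex_series_ext; [|exact (ex O)]|apply Series_ext];
      intros m; now rewrite sum_O.
  - split.
    + eapply ex_series_ext; [|exact (ex_series_plus _ _ IHex (ex (S N)))].
      intros m. now rewrite sum_Sn.
    + rewrite sum_Sn, IH. unfold plus; simpl.
      rewrite <- Series_plus by auto. apply Series_ext.
      intros m. now rewrite sum_Sn.
Qed.

(** The N-th partial sum over [n] of the column sums differs from the iterated sum by the series
    over [m] of [sum_n (a m) N - Series (a m)]. Each of these terms tends to 0 and is at most
    [2 * B m] in absolute value, so dominated convergence applies. *)
Lemma is_series_exchange (a : nat -> nat -> R) :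
  (forall m, ex_series (fun n => Rabs (a m n))) ->
  ex_series (fun m => Series (fun n => Rabs (a m n))) ->
  (forall n, ex_series (fun m => a m n)) /\ ex_series (fun m => Series (a m)) /\
  is_series (fun n => Series (fun m => a m n)) (Series (fun m => Series (a m))).
Proof.
  intros exr exB. set (B := fun m => Series (fun n => Rabs (a m n))) in *.
  assert (exa : forall m, ex_series (a m)) by (intros; now apply ex_series_Rabs).
  assert (hA : forall m, (Rabs (Series (a m)) <= B m)%R)
    by (intros; now apply Series_Rabs).
  assert (hS : forall m N, (Rabs (sum_n (a m) N) <= B m)%R)
    by (intros; now apply Rabs_sum_n_le_Series).
  assert (exc : forall n, ex_series (fun m => a m n)).
  { intros n. apply (ex_series_le (V := R_CompleteNormedModule) _ B); auto. intros m.
    apply (term_le_Series (fun k => Rabs (a m k))); auto.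
    intros k; apply Rabs_pos. }
  assert (exA : ex_series (fun m => Series (a m)))
    by now apply (ex_series_le (V := R_CompleteNormedModule) _ B).
  split; [|split]; auto.
  assert (lim0 : is_lim_seq
    (fun N => Series (fun m => sum_n (a m) N - Series (a m))%R) 0).
  { apply (Series_dominated_lim_0 _ (fun m => B m + B m)%R).
    - intros N m. eapply Rle_trans; [apply Rabs_triang|].
      rewrite Rabs_Ropp. generalize (hA m) (hS m N). lra.
    - now apply @ex_series_plus.
    - intros m.
      replace 0%R with (Series (a m) - Series (a m))%R by ring.
      apply is_lim_seq_minus'; [|apply is_lim_seq_const].
      exact (Series_correct _ (exa m)). }
  change (is_lim_seq (sum_n (fun n => Series (fun m => a m n)))
    (Series (fun m => Series (a m)))).
  apply (is_lim_seq_ext (fun N => (Series (fun m => sum_n (a m) N - Series (a m))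
    + Series (fun m => Series (a m)))%R)).
  { intros N. destruct (sum_n_Series (fun n m => a m n) N exc) as [exs ->].
    rewrite Series_minus by auto.
    unfold Rminus. now rewrite Rplus_assoc, Rplus_opp_l, Rplus_0_r. }
  pose proof (is_lim_seq_plus' _ _ _ _ lim0
    (is_lim_seq_const (Series (fun m => Series (a m))))) as h.
  rewrite Rplus_0_l in h. exact h.
Qed.

(** * Complex series through real and imaginary parts *)

(** The balls of [C] used here are products of real balls, so a limit in [C] is a pair of limits in
    [R]. *)
Lemma is_Cseries_components (a : nat -> C) (l : C) :
  @is_series C_AbsRing C_NormedModule a l <->
  is_series (fun n => Re (a n)) (Re l) /\ is_series (fun n => Im (a n)) (Im l).
Proof.
  assert (hRe : forall N, Re (@sum_n C_AbelianMonoid a N) = sum_n (fun n => Re (a n)) N).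
  { induction N. now rewrite !sum_O. rewrite !sum_Sn, <- IHN. reflexivity. }
  assert (hIm : forall N, Im (@sum_n C_AbelianMonoid a N) = sum_n (fun n => Im (a n)) N).
  { induction N. now rewrite !sum_O. rewrite !sum_Sn, <- IHN. reflexivity. }
  unfold is_series. split.
  - intros h. pose proof (proj1 (filterlim_locally _ l) h) as h'.
    split; apply filterlim_locally; intros eps;
      generalize (h' eps); apply filter_imp; intros N [h1 h2].
    + rewrite <- hRe. exact h1.
    + rewrite <- hIm. exact h2.
  - intros [h1 h2].
    apply (proj2 (filterlim_locally (F := eventually) (U := C_NormedModule) _ l)).
    intros eps.
    pose proof (proj1 (filterlim_locally _ _) h1 eps) as e1.
    pose proof (proj1 (filterlim_locally _ _) h2 eps) as e2.
    generalize (filter_and _ _ e1 e2). apply filter_imp.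
    intros N [c1 c2]. rewrite <- hRe in c1. rewrite <- hIm in c2. now split.
Qed.


Lemma is_Cseries_unique (a : nat -> C) (l : C) :
  @is_series C_AbsRing C_NormedModule a l -> CSeries a = l.
Proof.
  intros h. apply is_Cseries_components in h. destruct h as [h1 h2].
  unfold CSeries. apply is_series_unique in h1, h2. rewrite h1, h2.
  now destruct l.
Qed.

Lemma CSeries_correct (a : nat -> C) :
  ex_Cseries a -> @is_series C_AbsRing C_NormedModule a (CSeries a).
Proof. intros [l h]. now rewrite (is_Cseries_unique _ _ h). Qed.

Lemma ex_Cseries_le (a : nat -> C) (b : nat -> R) :
  (forall n, Cmod (a n) <= b n)%R -> ex_series b -> ex_Cseries a.
Proof. exact (@ex_series_le C_AbsRing C_CompleteNormedModule a b). Qed.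

Lemma is_Cseries_exchange (a : nat -> nat -> C) (b : nat -> nat -> R) :
  (forall m n, Cmod (a m n) <= b m n)%R ->
  (forall m, ex_series (b m)) ->
  ex_series (fun m => Series (b m)) ->
  (forall n, ex_Cseries (fun m => a m n)) /\ ex_Cseries (fun m => CSeries (a m)) /\
  @is_series C_AbsRing C_NormedModule (fun n => CSeries (fun m => a m n))
    (CSeries (fun m => CSeries (a m))).
Proof.
  intros hb exb exB.
  (* [p] stands for [Re] and [Im]: both are bounded by [Cmod], so one argument gives the hypotheses
     of the real exchange for each. *)
  assert (dom : forall p : C -> R, (forall w, Rabs (p w) <= Cmod w)%R ->
    (forall m, ex_series (fun n => Rabs (p (a m n)))) /\
    ex_series (fun m => Series (fun n => Rabs (p (a m n))))).
  { intros p hp.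
    assert (le : forall m n, (0 <= Rabs (p (a m n)) <= b m n)%R).
    { intros m n. split; [apply Rabs_pos|].
      eapply Rle_trans; [apply hp|apply hb]. }
    assert (exr : forall m, ex_series (fun n => Rabs (p (a m n)))).
    { intros m. apply (ex_series_le (V := R_CompleteNormedModule) _ (b m)); auto.
      intros n. change (Rabs (Rabs (p (a m n))) <= b m n)%R.
      rewrite Rabs_Rabsolu. apply le. }
    split; auto.
    apply (ex_series_le (V := R_CompleteNormedModule) _ (fun m => Series (b m))); auto.
    intros m. change (Rabs (Series (fun n => Rabs (p (a m n)))) <= Series (b m))%R.
    (* The inner sum is nonnegative because it dominates its own term of index 0. *)
    rewrite Rabs_pos_eq; [now apply Series_le|].
    eapply Rle_trans; [|apply (term_le_Series _ 0)]; auto; intros; apply le. }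
  destruct (dom Re re_le_Cmod) as [r1 r2].
  destruct (dom Im (fun w => Rle_trans _ _ _ (Rmax_r _ _) (Rmax_Cmod w))) as [i1 i2].
  apply is_series_exchange in r2, i2; auto.
  destruct r2 as [exr [[Sr hSr] sr]], i2 as [exi [[Si hSi] si]]. split; [|split].
  - intros n. destruct (exr n) as [lr hr], (exi n) as [li hi].
    exists (lr, li). now apply is_Cseries_components.
  - exists (Sr, Si). now apply is_Cseries_components.
  - now apply is_Cseries_components.
Qed.

(** * Complex powers of a positive real base *)

Lemma Cexp_plus (u v : C) : Cexp (u + v) = Cexp u * Cexp v.
Proof.
  destruct u, v. unfold Cexp, Cmult; simpl.
  rewrite exp_plus, cos_plus, sin_plus. f_equal; ring.
Qed.

Lemma Cmod_Cexp (w : C) : Cmod (Cexp w) = exp (Re w).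
Proof.
  unfold Cmod, Cexp; simpl fst; simpl snd.
  replace (_ + _)%R with (Rsqr (exp (Re w)) * (Rsqr (sin (Im w)) + Rsqr (cos (Im w))))%R
    by (unfold Rsqr; ring).
  rewrite sin2_cos2, Rmult_1_r. apply sqrt_Rsqr. left; apply exp_pos.
Qed.

(** The half-angle quotient is 0/(a+a), so the argument vanishes and only the real logarithm
    remains. All power laws below follow from this form, with no branch to track. *)
Lemma Cpower_pos (a : R) (w : C) : (0 < a)%R -> Cpower a w = Cexp (w * ln a).
Proof.
  intros ha. unfold Cpower. do 2 f_equal. unfold Clog, Carg.
  rewrite Cmod_R, Rabs_pos_eq by lra. simpl.
  replace (0 / (a + a))%R with 0%R by (field; lra).
  rewrite atan_0, Rmult_0_r. reflexivity.
Qed.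

Lemma Cmod_Cpower (a : R) (w : C) :
  (0 < a)%R -> Cmod (Cpower a w) = Rpower a (Re w).
Proof.
  intros ha. rewrite Cpower_pos, Cmod_Cexp by auto. unfold Rpower.
  f_equal. destruct w; simpl. ring.
Qed.

Lemma Cpower_plus (a : R) (u v : C) :
  (0 < a)%R -> Cpower a (u + v) = Cpower a u * Cpower a v.
Proof.
  intros ha. rewrite !Cpower_pos, <- Cexp_plus by auto. f_equal. ring.
Qed.

Lemma Cpower_1 (a : R) : (0 < a)%R -> Cpower a 1 = a.
Proof.
  intros ha. rewrite Cpower_pos by auto. unfold Cexp; simpl.
  replace (1 * 0 + 0 * ln a)%R with 0%R by ring.
  replace (1 * ln a - 0 * 0)%R with (ln a) by ring.
  rewrite exp_ln, cos_0, sin_0 by auto. unfold RtoC. f_equal; ring.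
Qed.

Lemma Cpower_0 (a : R) : (0 < a)%R -> Cpower a 0 = 1.
Proof.
  intros ha. rewrite Cpower_pos by auto.
  replace (0 * ln a) with (RtoC 0) by ring.
  unfold Cexp; simpl. rewrite exp_0, cos_0, sin_0. unfold RtoC. f_equal; ring.
Qed.

Lemma Cpower_neg (a : R) (w : C) :
  (0 < a)%R -> Cpower a w <> 0 /\ Cpower a (- w) = / Cpower a w.
Proof.
  intros ha.
  assert (h : Cpower a w * Cpower a (- w) = 1).
  { rewrite <- Cpower_plus, Cplus_opp_r by auto. now apply Cpower_0. }
  assert (nz : Cpower a w <> 0).
  { intros e. rewrite e, Cmult_0_l in h. apply C1_nz. now symmetry. }
  split; auto. rewrite <- (Cmult_1_r (/ _)), <- h. now field.
Qed.

Lemma Cpower_mult_base (a b : R) (w : C) :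
  (0 < a)%R -> (0 < b)%R -> Cpower (a * b)%R w = Cpower a w * Cpower b w.
Proof.
  intros ha hb. rewrite !Cpower_pos by (auto; now apply Rmult_lt_0_compat).
  rewrite <- Cexp_plus, ln_mult, RtoC_plus by auto. f_equal. ring.
Qed.

(** * Power estimates and the convergence of the p-series *)

(** The right side is the integral of (s-1) t^(-s) over [b-1, b]. The bound is obtained without
    integrals from exp u >= 1 + u, used twice: b - 1 = b (1 - 1/b) <= b exp(-1/b) bounds ln(b-1),
    and then exp((s-1)/b) >= 1 + (s-1)/b. *)
Lemma Rpower_pred_ge (s b : R) :
  (1 < s)%R -> (1 < b)%R ->
  ((s - 1) * Rpower b (- s) <= Rpower (b - 1) (1 - s) - Rpower b (1 - s))%R.
Proof.
  intros hs hb.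
  assert (hln : (ln (b - 1) <= ln b - / b)%R).
  { rewrite <- (ln_exp (ln b - / b)). apply ln_le; [lra|].
    unfold Rminus at 2. rewrite exp_plus, exp_ln by lra.
    apply Rle_trans with (b * (1 + - / b))%R; [right; field; lra|].
    apply Rmult_le_compat_l; [lra|apply exp_ineq1_le]. }
  assert (h : (Rpower b (1 - s) * (1 + (s - 1) * / b) <= Rpower (b - 1) (1 - s))%R).
  { apply Rle_trans with (Rpower b (1 - s) * exp ((s - 1) * / b))%R.
    - apply Rmult_le_compat_l; [left; apply exp_pos|apply exp_ineq1_le].
    - unfold Rpower. rewrite <- exp_plus. apply Rnot_lt_le. intros h.
      apply exp_lt_inv in h. nra. }
  replace (Rpower b (- s)) with (Rpower b (1 - s) * / b)%R; [lra|].
  replace (1 - s)%R with (- s + 1)%R by ring.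
  rewrite Rpower_plus, Rpower_1 by lra. field. lra.
Qed.

Lemma ex_series_Rpower (s : R) :
  (1 < s)%R -> ex_series (fun n => Rpower (INR (S n)) (- s)).
Proof.
  (* The first term is split off because [Rpower_pred_ge] needs a base above 1. The remaining terms,
     scaled by s-1, are bounded by differences of [t], so their partial sums telescope and stay
     below [t 0]. *)
  intros hs. apply ex_series_incr_1.
  set (t := fun n => Rpower (INR (S n)) (1 - s)).
  set (u := fun n => ((s - 1) * Rpower (INR (S (S n))) (- s))%R).
  assert (eq : forall n, (/ (s - 1) * u n)%R = Rpower (INR (S (S n))) (- s)).
  { intros n. unfold u. field. lra. }
  apply (ex_series_ext _ _ eq), @ex_series_scal_l.
  assert (hu : forall n, (u n <= t n - t (S n))%R).
  { intros n. unfold u, t. replace (INR (S n)) with (INR (S (S n)) - 1)%R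
      by (rewrite (S_INR (S n)); ring).
    apply Rpower_pred_ge; auto. rewrite !S_INR. generalize (pos_INR n). lra. }
  apply (ex_finite_lim_seq_incr (sum_n u) (t 0%nat)).
  - intros n. rewrite sum_Sn. unfold plus; simpl.
    assert (0 <= u (S n))%R
      by (apply Rmult_le_pos; [lra|left; apply exp_pos]). lra.
  - assert (h : forall n, (sum_n u n <= t 0%nat - t (S n))%R).
    { induction n as [|n IH]; [rewrite sum_O; apply hu|].
      rewrite sum_Sn. unfold plus; simpl. generalize (hu (S n)). lra. }
    intros n. generalize (h n) (exp_pos ((1 - s) * ln (INR (S (S n))))).
    unfold t, Rpower. lra.
Qed.

(** Write the power as (a+b)^(-p) (a+b)^(-q) and shrink the base to a in one factor and to b in the
    other. This separates the variables of the double series. *)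
Lemma Rpower_plus_base_le (a b p q : R) :
  (0 < a)%R -> (0 < b)%R -> (0 <= p)%R -> (0 <= q)%R ->
  (Rpower (a + b) (- (p + q)) <= Rpower a (- p) * Rpower b (- q))%R.
Proof.
  intros ha hb hp hq. unfold Rpower. rewrite <- exp_plus.
  apply Rnot_lt_le. intros h. apply exp_lt_inv in h.
  assert (ln a <= ln (a + b))%R by (apply ln_le; lra).
  assert (ln b <= ln (a + b))%R by (apply ln_le; lra).
  nra.
Qed.

Lemma INR_S_pos (n : nat) : (0 < INR (S n))%R.
Proof. apply lt_0_INR. lia. Qed.

Lemma Cpower_1_minus (a : R) (z : C) :
  (0 < a)%R -> Cpower a (1 - z) = a * Cpower a (- z).
Proof.
  intros ha. unfold Cminus. now rewrite Cpower_plus, Cpower_1.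
Qed.

Lemma Cpower_inv_base (a : R) (w : C) :
  (0 < a)%R -> Cpower (1 / a)%R w = / Cpower a w.
Proof.
  intros ha. destruct (Cpower_neg a w ha) as [nz _].
  assert (h : Cpower (1 / a)%R w * Cpower a w = 1).
  { rewrite <- Cpower_mult_base by (auto; apply Rdiv_lt_0_compat; lra).
    replace (1 / a * a)%R with 1%R by (field; lra).
    rewrite Cpower_pos by lra. rewrite ln_1, Cmult_0_r.
    unfold Cexp; simpl. rewrite exp_0, cos_0, sin_0. unfold RtoC. f_equal; ring. }
  rewrite <- (Cmult_1_l (/ _)), <- h. now field.
Qed.

(** * The zeta and Hurwitz zeta series *)

Lemma ex_Cseries_Cpower (y : R) (z : C) :
  (0 <= y)%R -> (1 < Re z)%R ->
  ex_Cseries (fun k => Cpower (INR (S k) + y)%R (- z)).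
Proof.
  intros hy hz. apply (ex_Cseries_le _ (fun k => Rpower (INR (S k)) (- Re z))).
  - intros k. pose proof (INR_S_pos k) as hk. rewrite Cmod_Cpower by lra.
    change (Re (- z)) with (- Re z)%R. rewrite !Rpower_Ropp.
    apply Rinv_le_contravar; [apply exp_pos|].
    apply Rle_Rpower_l; lra.
  - now apply ex_series_Rpower.
Qed.

Lemma is_Cseries_zeta (z : C) :
  (1 < Re z)%R ->
  @is_series C_AbsRing C_NormedModule (fun k => Cpower (INR (S k)) (- z)) (zeta z).
Proof.
  intros hz. apply CSeries_correct.
  apply (@ex_series_ext C_AbsRing C_NormedModule)
    with (2 := ex_Cseries_Cpower 0 z (Rle_refl 0) hz).
  intros k. now rewrite Rplus_0_r.
Qed.

Lemma hurwitz_zeta_split (z : C) (y : R) :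
  (1 < Re z)%R -> (0 < y)%R ->
  hurwitz_zeta z y =
    Cpower y (- z) + CSeries (fun k => Cpower (INR (S k) + y)%R (- z)).
Proof.
  intros hz hy. apply is_Cseries_unique, is_series_decr_1.
  match goal with |- is_series _ ?l =>
    replace l with (CSeries (fun k => Cpower (INR (S k) + y)%R (- z))) end.
  - apply (is_series_ext (fun k => Cpower (INR (S k) + y)%R (- z))).
    + intros k. now rewrite RtoC_plus.
    + apply CSeries_correct, ex_Cseries_Cpower; lra.
  - simpl. rewrite Cplus_0_l. unfold plus, opp; simpl. ring.
Qed.

(** * The tail double sum and the identity for Phi *)

(** Both indices are shifted to start at 1, and [m] is the one paired with [x]. The base is formed
    in [R] before coercion, so that the power laws for positive bases apply. *)
Definition tail_term (z : C) (x : R) (m n : nat) : C :=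
  1 / INR (S m) * Cpower (INR (S n) + INR (S m) * x)%R (- z).

(** This is T(x) of the overview, with [m] as the outer index. *)
Definition tail_sum (z : C) (x : R) : C :=
  CSeries (fun m => CSeries (tail_term z x m)).

Lemma tail_term_exchange (z : C) (x : R) :
  (1 < Re z)%R -> (0 < x)%R ->
  (forall n, ex_Cseries (fun m => tail_term z x m n)) /\
  ex_Cseries (fun m => CSeries (tail_term z x m)) /\
  @is_series C_AbsRing C_NormedModule
    (fun n => CSeries (fun m => tail_term z x m n)) (tail_sum z x).
Proof.
  intros hz hx. set (d := ((Re z - 1) / 2)%R).
  assert (hd : (0 < d)%R) by (unfold d; lra).
  (* Re z is split as (1+d) + d. The index n receives 1+d, while m receives d and gains 1 more from
     the prefactor 1/m, so both exponents exceed 1. *)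
  apply (is_Cseries_exchange _ (fun m n =>
    (Rpower x (- d) * Rpower (INR (S m)) (- (1 + d)))
      * Rpower (INR (S n)) (- (1 + d)))%R).
  - intros m n. unfold tail_term.
    pose proof (INR_S_pos m) as hm. pose proof (INR_S_pos n) as hn.
    pose proof (Rmult_lt_0_compat _ _ hm hx) as hmx.
    rewrite Cmod_mult, Cmod_Cpower, <- RtoC_div, Cmod_R by lra.
    rewrite Rabs_pos_eq by (apply Rlt_le, Rdiv_lt_0_compat; lra).
    change (Re (- z)) with (- Re z)%R.
    replace (Re z) with ((1 + d) + d)%R by (unfold d; field).
    apply Rle_trans with (1 / INR (S m) *
      (Rpower (INR (S n)) (- (1 + d)) * Rpower (INR (S m) * x) (- d)))%R.
    + apply Rmult_le_compat_l; [apply Rlt_le, Rdiv_lt_0_compat; lra|].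
      apply Rpower_plus_base_le; lra.
    + right. rewrite <- Rpower_mult_distr by auto.
      rewrite (Ropp_plus_distr 1 d), !Rpower_plus,
        (Rpower_Ropp (INR (S m)) 1), Rpower_1 by auto.
      field. lra.
  - intros m. apply @ex_series_scal_l, ex_series_Rpower. lra.
  - apply (ex_series_ext (fun m => scal
      (Rpower x (- d) * Series (fun n => Rpower (INR (S n)) (- (1 + d))))%R
      (Rpower (INR (S m)) (- (1 + d))))).
    + intros m. rewrite Series_scal_l.
      unfold scal; simpl; unfold mult; simpl. ring.
    + apply @ex_series_scal_l, ex_series_Rpower. lra.
Qed.

(** The summand of [Phi] is a combination of m^(-(z+1)), the inner tail sum and m^(-z). Each of the
    three series converges separately, so they may be added term by term. *)
Lemma Phi_tail_sum (z : C) (x : R) :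
  (1 < Re z)%R -> (0 < x)%R ->
  Phi z x = Cpower x (- z) * zeta (z + 1) + tail_sum z x
    - Cpower x (1 - z) / (z - 1) * zeta z.
Proof.
  intros hz hx. apply is_Cseries_unique.
  assert (h1 : @is_series C_AbsRing C_NormedModule
    (fun k => Cpower (INR (S k)) (- (z + 1))) (zeta (z + 1))).
  { apply is_Cseries_zeta. destruct z; simpl in *; lra. }
  pose proof (is_Cseries_zeta z hz) as h2.
  destruct (tail_term_exchange z x hz hx) as [_ [h3 _]].
  apply CSeries_correct in h3.
  apply (is_series_scal (Cpower x (- z))) in h1.
  apply (is_series_scal (Cpower x (1 - z) / (z - 1))) in h2.
  eapply is_series_ext;
    [|exact (is_series_minus _ _ _ _ (is_series_plus _ _ _ _ h1 h3) h2)].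
  intros m. cbv beta zeta.
  match goal with |- plus (plus (scal ?a ?b) ?c) (opp (scal ?d ?e)) = ?r =>
    change (a * b + c - d * e = r) end.
  pose proof (INR_S_pos m) as hm.
  pose proof (Rmult_lt_0_compat _ _ hm hx) as hmx.
  rewrite <- RtoC_mult, hurwitz_zeta_split by auto.
  (* Pulling 1/m out of the inner series makes it match the tail of the Hurwitz value. *)
  assert (e : CSeries (tail_term z x m) = 1 / INR (S m) *
    CSeries (fun n => Cpower (INR (S n) + INR (S m) * x)%R (- z))).
  { apply is_Cseries_unique.
    apply (is_series_scal (1 / INR (S m) : C)
      (fun n => Cpower (INR (S n) + INR (S m) * x)%R (- z))).
    apply CSeries_correct, ex_Cseries_Cpower; lra. }
  rewrite e, !Cpower_1_minus, Cpower_mult_base by auto.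
  (* Every power is now reduced to m^(-z) and x^(-z), which leaves a rational identity. *)
  replace (- (z + 1)) with (- z + - (1)) by ring.
  destruct (Cpower_neg (INR (S m)) 1 hm) as [_ i1].
  rewrite Cpower_plus, i1, Cpower_1, RtoC_mult by auto.
  assert (nm : RtoC (INR (S m)) <> 0) by (intros E; apply RtoC_inj in E; lra).
  assert (nz : z - 1 <> 0).
  { intros E. apply (f_equal Re) in E. destruct z; simpl in *; lra. }
  field. auto.
Qed.

(** Homogeneity: n + m x = x (m + n/x), so x^(-z) turns the tail term at 1/x, taken with m and n
    swapped, into one with the same power (n + m x)^(-z). *)
Lemma double_term_tail_terms (z : C) (x : R) (m n : nat) :
  (0 < x)%R ->
  double_term z x (S n) (S m) =
    tail_term z x m n + Cpower x (1 - z) * tail_term z (1 / x)%R n m.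
Proof.
  intros hx. unfold double_term, tail_term.
  pose proof (INR_S_pos m) as hm. pose proof (INR_S_pos n) as hn.
  pose proof (Rmult_lt_0_compat _ _ hm hx) as hmx.
  (* Only positivity of the two indices matters from here on. *)
  set (M := INR (S m)) in *. set (N := INR (S n)) in *. clearbody M N.
  assert (hy : (0 < M + N * (1 / x))%R).
  { apply Rplus_lt_0_compat; auto. apply Rmult_lt_0_compat; auto.
    apply Rdiv_lt_0_compat; lra. }
  assert (e : Cpower (N + M * x)%R (- z) =
    Cpower x (- z) * Cpower (M + N * (1 / x))%R (- z)).
  { rewrite <- Cpower_mult_base by auto. do 2 f_equal. field. lra. }
  rewrite Cpower_1_minus by auto.
  (* This turns the power in the denominator into the inverse of (n + m x)^(1-z), which is then
     expressed by (n + m x)^(-z). *)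
  replace (z - 1) with (- (1 - z)) by ring.
  rewrite <- (RtoC_mult M x), <- RtoC_plus.
  destruct (Cpower_neg (N + M * x)%R (- z)) as [nP _]; [lra|].
  destruct (Cpower_neg (N + M * x)%R (1 - z)) as [_ ->]; [lra|].
  rewrite Cpower_1_minus by lra.
  transitivity ((1 / M + x / N) * Cpower (N + M * x)%R (- z)); [|rewrite e].
  - assert (M <> 0 :> C) by (intros E; apply RtoC_inj in E; lra).
    assert (N <> 0 :> C) by (intros E; apply RtoC_inj in E; lra).
    assert (RtoC (N + M * x) <> 0) by (intros E; apply RtoC_inj in E; lra).
    rewrite RtoC_plus, RtoC_mult in * |- *. field. auto.
  - field.
    split; intros E; apply RtoC_inj in E; lra.
Qed.

(** The two convergence claims accompany the identity because [CSeries] also assigns a value to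
    divergent series. *)
Theorem theorem1p3 (z : C) (x : R) (hz : (1 < Re z)%R) (hx : (0 < x)%R) :
  (forall n : nat, ex_Cseries (fun m => double_term z x (S n) (S m))) /\
  ex_Cseries (fun n => CSeries (fun m => double_term z x (S n) (S m))) /\
  Phi z x + Cpower x (1 - z) * Phi z (1 / x) =
    CSeries (fun n => CSeries (fun m => double_term z x (S n) (S m)))
    - (1 + Cpower x (1 - z)) / (z - 1) * zeta z
    + (x + Cpower x (- z)) * zeta (z + 1).
Proof.
  assert (hx' : (0 < 1 / x)%R) by (apply Rdiv_lt_0_compat; lra).
  (* Only T(x) has its sums exchanged. In T(1/x) the outer index is already the one that plays the
     role of n in the double series. *)
  destruct (tail_term_exchange z x hz hx) as [exr [_ hr]].
  destruct (tail_term_exchange z (1 / x) hz hx') as [_ [exl _]].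
  apply CSeries_correct, (is_series_scal (Cpower x (1 - z))) in exl.
  assert (inner : forall n, @is_series C_AbsRing C_NormedModule
    (fun m => double_term z x (S n) (S m))
    (CSeries (fun m => tail_term z x m n)
      + Cpower x (1 - z) * CSeries (tail_term z (1 / x)%R n))).
  { intros n.
    assert (h : ex_Cseries (tail_term z (1 / x)%R n)).
    { apply @ex_series_scal, ex_Cseries_Cpower; auto.
      pose proof (INR_S_pos n). apply Rlt_le, Rmult_lt_0_compat; auto. }
    apply CSeries_correct, (is_series_scal (Cpower x (1 - z))) in h.
    eapply is_series_ext;
      [|exact (is_series_plus _ _ _ _ (CSeries_correct _ (exr n)) h)].
    intros m. symmetry. now apply double_term_tail_terms. }
  assert (outer : @is_series C_AbsRing C_NormedModule
    (fun n => CSeries (fun m => double_term z x (S n) (S m)))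
    (tail_sum z x + Cpower x (1 - z) * tail_sum z (1 / x)%R)).
  { eapply is_series_ext; [|exact (is_series_plus _ _ _ _ hr exl)].
    intros n. symmetry. apply is_Cseries_unique, inner. }
  split; [|split].
  - intros n. eexists. apply inner.
  - eexists. exact outer.
  (* With all powers written through x^(-z), the factor x^(1-z) cancels against those of 1/x:
     x^(1-z) x^z = x gives the term x zeta(z+1), and x^(1-z) x^(z-1) = 1 gives the 1 in the
     coefficient of zeta(z). *)
  - rewrite (is_Cseries_unique _ _ outer), <- RtoC_div by lra.
    rewrite !Phi_tail_sum, !Cpower_inv_base, !Cpower_1_minus by auto.
    destruct (Cpower_neg x (- z) hx) as [nX _].
    assert (nx : RtoC x <> 0) by (intros E; apply RtoC_inj in E; lra).
    assert (nz : z - 1 <> 0).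
    { intros E. apply (f_equal Re) in E. destruct z; simpl in *; lra. }
    field. auto.
Qed.
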